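(* Assume $(\Omega,d)$ is a nonempty metric space. Let $P$ be an ARB Markov kernel on $\Omega$ that is reversible with respect to $\Pi$ and whose acceptance probability $A(\cdot)$ is upper semicontinuous. Then the conductance $k_P$ of $P$ satisfies $$k_P\ \le\ \inf_{\theta\in\Theta}A(\theta).$$
   Context: $\mathcal{B}(\Omega)$ is the Borel sigma-algebra of $(\Omega,d)$. $\Pi$ is a probability measure on $(\Omega,\mathcal{B}(\Omega))$ supported on a nonempty measurable set $\Theta\subseteq\Omega$, having density $\pi$ with respect to a sigma-finite measure $\lambda$ on $(\Omega,\mathcal{B}(\Omega))$; the support of $\pi$ is $\Theta$, so $\pi(\theta)>0$ for each $\theta\in\Theta$. For each $\theta\in\Theta$, $\{\theta\}$ is Borel measurable with $\lambda(\{\theta\})=0$, and $\lambda$ is strictly positive: $\lambda(U)>0$ for all nonempty measurable sets $U\subseteq\Theta$ that are open in $\Theta$ (relative topology). ARB kernel: for each $\theta\in\Omega$, $Q(\theta,\cdot)$ is a proposal distribution on $(\Omega,\mathcal{B}(\Omega))$ with density $q(\theta,\cdot)$ with respect to $\lambda$. Given an acceptance function $a:\Omega\times\Omega\to[0,1]$, the acceptance probability is $A(\theta)=\int a(\theta,\theta')q(\theta,\theta')\,d\lambda(\theta')$, and the ARB Markov kernel is $$P(\theta,B)=\int_B a(\theta,\theta')q(\theta,\theta')\,d\lambda(\theta')+\delta_\theta(B)[1-A(\theta)],\qquad \theta\in\Omega,\ B\in\mathcal{B}(\Omega),$$ where $\delta_\theta$ is the Dirac measure at $\theta$. Conductance: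 for measurable $B$ with $0<\Pi(B)<1$, $k_P(B)=\dfrac{\int_B P(\theta,B^c)\,d\Pi(\theta)}{\Pi(B)\Pi(B^c)}$, and $k_P=\inf\{k_P(B):0<\Pi(B)<1\}$. *)

(* Defs.v *)
From HB Require Import structures.
From mathcomp Require Import all_boot all_order all_algebra.
From mathcomp Require Import all_classical all_reals all_analysis.

Set Implicit Arguments.
Unset Strict Implicit.
Unset Printing Implicit Defensive.

Import Order.TTheory GRing.Theory Num.Theory.

Local Open Scope classical_set_scope.
Local Open Scope ring_scope.
Local Open Scope ereal_scope.

(* Nonempty metric spaces: measurable types are pointed, so nonemptiness is
   carried by a (otherwise unused) base point. *)
#[short(type="pointedMetricType")]
HB.structure Definition PointedMetric (K : numDomainType) :=
  {T of Pointed T & Metric K T}.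

Notation borel T := (g_sigma_algebraType (@open T)).

(* The counterpart of the library's lower_semicontinuous. *)
Definition upper_semicontinuous (T : topologicalType) (R : numFieldType)
    (f : T -> \bar R) :=
  forall x (c : R), f x < c%:E ->
    exists2 V, nbhs x V & forall y, V y -> f y < c%:E.

Section markov.
Context d (T : measurableType d) (R : realType).

Definition has_density (lambda nu : {measure set T -> \bar R}) (f : T -> R) :=
  [/\ measurable_fun setT f,
      forall x, (0 <= f x)%R &
      forall B, measurable B -> nu B = \int[lambda]_(x in B) (f x)%:E].

Definition acceptance (lambda : {measure set T -> \bar R}) (a q : T -> T -> R)
    (theta : T) : \bar R :=
  \int[lambda]_x (a theta x * q theta x)%:E.

(* Accept-reject-based kernel, as a set function at each point; B is assumed
   measurable wherever it is used. *)
Definition arb (lambda : {measure set T -> \bar R}) (a q : T -> T -> R)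
    (theta : T) (B : set T) : \bar R :=
  \int[lambda]_(x in B) (a theta x * q theta x)%:E
  + \d_theta B * (1 - acceptance lambda a q theta).

Definition reversible (Pi : probability T R) (P : R.-pker T ~> T) :=
  forall B C, measurable B -> measurable C ->
    \int[Pi]_(theta in B) P theta C = \int[Pi]_(theta in C) P theta B.

Definition set_conductance (Pi : probability T R) (P : R.-pker T ~> T)
    (B : set T) : \bar R :=
  (\int[Pi]_(theta in B) P theta (~` B)) / (Pi B * Pi (~` B)).

Definition conductance (Pi : probability T R) (P : R.-pker T ~> T) : \bar R :=
  ereal_inf [set set_conductance Pi P B |
    B in [set B | measurable B /\ 0 < Pi B < 1]].

End markov.

(* Main.v *)
Require Import Defs.
From HB Require Import structures.
From mathcomp Require Import all_boot all_order all_algebra.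
From mathcomp Require Import all_classical all_reals all_analysis.
From mathcomp Require Import measurable_realfun.

Set Implicit Arguments.
Unset Strict Implicit.
Unset Printing Implicit Defensive.

Import Order.TTheory GRing.Theory Num.Theory.

Local Open Scope classical_set_scope.
Local Open Scope ring_scope.
Local Open Scope ereal_scope.

(** The chain leaves a set B only by an accepted move, so from each theta' in B
    it leaves with probability at most A(theta') ([arb_setC_le_acceptance]).
    Let theta be a point of Theta and e > 0.  Upper semicontinuity keeps A below
    A(theta) + e on a neighbourhood of theta; for B inside that neighbourhood
    the flow out of B is at most (A(theta) + e) Pi(B), and the conductance of B
    is at most (A(theta) + e) / (1 - Pi(B)) ([set_conductance_le]).  It remains
    to make Pi(B) small but nonzero.  The point theta is lambda-null, hence Pi-null, so
    small enough balls around it have small probability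
    ([null_point_small_open]); their traces on Theta are relatively open, hence
    not lambda-null, and the density is positive there, so they have positive
    probability ([has_density_gt0]).  Letting Pi(B) and e tend to 0 gives the
    bound A(theta). *)

Lemma has_density_null d (T : measurableType d) (R : realType)
    (lambda nu : {measure set T -> \bar R}) (f : T -> R) (B : set T) :
  has_density lambda nu f -> measurable B -> lambda B = 0 -> nu B = 0.
Proof.
move=> [mf _ nuE] mB B0; rewrite nuE// null_set_integral//.
by apply/measurable_EFinP; exact: measurable_funTS.
Qed.

(** An integral of a positive function over a set can only vanish when the
    set is null. *)
Lemma has_density_gt0 d (T : measurableType d) (R : realType)
    (lambda nu : {measure set T -> \bar R}) (f : T -> R) (B : set T) :
  has_density lambda nu f -> measurable B -> (forall x, B x -> (0 < f x)%R) ->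
  0 < lambda B -> 0 < nu B.
Proof.
move=> [mf f0 nuE] mB fB lB; rewrite lt0e measure_ge0 andbT.
apply/eqP => nuB0; move: lB; apply/negP; rewrite -leNgt.
have mfB : measurable_fun B (EFin \o f).
  by apply/measurable_EFinP; exact: measurable_funTS.
have [N [mN N0 BN]] : ae_eq lambda B (EFin \o f) (cst 0).
  apply/(ae_eq_integral_abs lambda mB mfB); rewrite -nuB0 nuE//.
  by apply: eq_integral => x _; rewrite /= ger0_norm.
rewrite -N0; apply: le_measure; rewrite ?inE// => x Bx.
apply: BN => /= /(_ Bx) [fx0].
by have := fB _ Bx; rewrite fx0 ltxx.
Qed.

(** By continuity from above along the balls of radius 1/(n+1), whose
    intersection is the point since distinct points are at positive
    distance. *)
Lemma null_point_small_open (R : realType) (T : pointedMetricType R)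
    (mu : probability (borel T) R) (x : T) (V : set T) (e : R) :
  measurable ([set x] : set (borel T)) -> mu [set x] = 0 -> nbhs x V ->
  (0 < e)%R ->
  exists U : set T, [/\ open U, U x, U `<=` V & mu U < e%:E].
Proof.
move=> mx x0 xV e0.
pose F n : set T := (ball x n.+1%:R^-1)° `&` V°.
have oF n : open (F n) by apply: openI; exact: open_interior.
have mF n : measurable (F n : set (borel T)) by exact: sub_sigma_algebra.
have Fx n : F n x.
  split; last exact: xV.
  by apply: nbhsx_ballx; rewrite invr_gt0.
have capF : \bigcap_n F n = [set x].
  apply/seteqP; split => [y Fy|y ->]; last by move=> n _; exact: Fx.
  apply/esym/eqP; rewrite -[_ == _]negbK; apply/negP; rewrite -mdist_gt0 => xy.
  have [n _ /(_ n (leqnn n)) /= nxy] := near_infty_natSinv_lt (PosNum xy).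
  have [/interior_subset + _] := Fy n I.
  by rewrite ballEmdist/= ltNge (ltW nxy).
have : mu \o F @ \oo --> 0.
  rewrite -x0 -capF; apply: nonincreasing_cvg_mu => //.
  - by rewrite (le_lt_trans (probability_le1 _ _))// ltry.
  - by rewrite capF.
  - move=> m n mn; apply/subsetPset; apply: setSI; apply: interiorS.
    by apply: le_ball; rewrite lef_pV2 ?posrE// ler_nat.
move=> /(_ _ (nbhs_open_ereal_lt (r := 0%R) (f := fun=> e) e0)) [n _ Fe].
exists (F n); split => //.
  by move=> y [_ /interior_subset].
exact: (Fe n (leqnn n)).
Qed.

(** The atom of the kernel at theta does not charge the complement of a set
    containing theta: leaving requires an accepted move. *)
Lemma arb_setC_le_acceptance d (T : measurableType d) (R : realType)
    (lambda : {measure set T -> \bar R}) (a q : T -> T -> R) (theta : T)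
    (B : set T) :
  measurable_fun setT (a theta) -> measurable_fun setT (q theta) ->
  (forall x, 0 <= a theta x)%R -> (forall x, 0 <= q theta x)%R ->
  measurable B -> B theta ->
  arb lambda a q theta (~` B) <= acceptance lambda a q theta.
Proof.
move=> ma mq a0 q0 mB Bt; rewrite /arb diracE memNset; last by apply.
rewrite mul0e adde0; apply: ge0_subset_integral => //.
- exact: measurableC.
- by apply/measurable_EFinP; exact: measurable_funM.
- by move=> x _; rewrite lee_fin mulr_ge0.
Qed.

(** The flow out of B is at most c Pi(B); the factor Pi(B) cancels, and the
    second bound says that k dominates what is left, c / (1 - Pi(B)). *)
Lemma set_conductance_le d (T : measurableType d) (R : realType)
    (Pi : probability T R) (P : R.-pker T ~> T) (B : set T) (c k : R) :
  measurable B -> 0 < Pi B < 1 ->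
  (forall theta, B theta -> P theta (~` B) <= c%:E) ->
  c%:E <= k%:E * (1 - Pi B) ->
  set_conductance Pi P B <= k%:E.
Proof.
move=> mB /andP[B0 B1] Pc ck.
have flow : \int[Pi]_(theta in B) P theta (~` B) <= c%:E * Pi B.
  rewrite -integral_cst//; apply: ge0_le_integral => //.
  exact/measurable_funTS/measurable_kernel/measurableC.
rewrite /set_conductance probability_setC//.
have [p pE] : exists p, Pi B = p%:E.
  by exists (fine (Pi B)); rewrite fineK// fin_num_measure.
move: B0 B1 ck flow; rewrite pE !lte_fin -EFinB -!EFinM lee_fin => p0 p1 ck flow.
have pp : (0 < p * (1 - p))%R by rewrite mulr_gt0// subr_gt0.
rewrite inver gt_eqF// lee_pdivrMr// (le_trans flow)// -EFinM lee_fin.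
by rewrite mulrCA [leLHS]mulrC ler_pM2l.
Qed.

Theorem proposition1 (R : realType) (Omega : pointedMetricType R)
  (lambda : {sigma_finite_measure set (borel Omega) -> \bar R})
  (Pi : probability (borel Omega) R) (pi : Omega -> R) (Theta : set Omega)
  (Theta_measurable : measurable (Theta : set (borel Omega)))
  (Theta_nonempty : Theta !=set0)
  (Pi_supported : Pi Theta = 1)
  (Pi_density : has_density lambda Pi pi)
  (pi_support : [set theta | (0 < pi theta)%R] = Theta)
  (lambda_points : forall theta : Omega, Theta theta ->
    measurable ([set theta] : set (borel Omega)) /\ lambda [set theta] = 0)
  (lambda_strictly_positive : forall U : set Omega,
    measurable (U : set (borel Omega)) -> U !=set0 -> U `<=` Theta ->
    open (U : set (subspace Theta)) -> 0 < lambda U)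
  (Q : Omega -> probability (borel Omega) R) (q : Omega -> Omega -> R)
  (Q_density : forall theta : Omega, has_density lambda (Q theta) (q theta))
  (a : Omega -> Omega -> R)
  (a_range : forall theta theta' : Omega, (0 <= a theta theta' <= 1)%R)
  (a_measurable : forall theta : Omega,
    measurable_fun [set: borel Omega] (a theta))
  (P : R.-pker (borel Omega) ~> (borel Omega))
  (P_arb : forall (theta : borel Omega) (B : set (borel Omega)),
    measurable B -> P theta B = arb lambda a q theta B)
  (P_reversible : reversible Pi P)
  (A_usc : @upper_semicontinuous Omega R (acceptance lambda a q)) :
  conductance Pi P
    <= ereal_inf [set acceptance lambda a q theta | theta in Theta].
Proof.
apply: le_ereal_inf_tmp => _ [theta Theta_theta <-].
have A_ge0 : 0 <= acceptance lambda a q theta.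
  apply: integral_ge0 => x _; rewrite lee_fin mulr_ge0//.
    by have /andP[] := a_range theta x.
  by have [_ ->] := Q_density theta.
case AE: (acceptance lambda a q theta) A_ge0 => [A| |] // A_ge0; last first.
  by rewrite leey.
apply/lee_addgt0Pr => e e0; rewrite -EFinD.
rewrite lee_fin in A_ge0.
have Ae0 : (0 < A + e)%R by rewrite ltr_wpDl.
have e20 : (0 < e / 2)%R by rewrite divr_gt0.
have [|V thetaV VA] := A_usc theta (A + e / 2)%R.
  by rewrite AE lte_fin ltrDl.
have [mtheta theta0] := lambda_points theta Theta_theta.
have Pi_theta := has_density_null Pi_density mtheta theta0.
(* With Pi(U) < p, this p gives (A + e) (1 - p) = A + e / 2. *)
pose p := (e / 2 / (A + e))%R.
have p0 : (0 < p)%R by rewrite divr_gt0.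
have [U [oU Utheta UV Up]] := null_point_small_open mtheta Pi_theta thetaV p0.
pose B : set (borel Omega) := U `&` Theta.
have mU : measurable (U : set (borel Omega)) by exact: sub_sigma_algebra.
have mB : measurable B by exact: measurableI.
have BU : Pi B <= Pi U by apply: le_measure; rewrite ?inE//; exact: subIsetl.
have Bp : Pi B < p%:E := le_lt_trans BU Up.
have p1 : (p < 1)%R.
  by rewrite ltr_pdivrMr// mul1r ltr_wpDl// ltr_pdivrMr// ltr_pMr// ltr1n.
have B0 : 0 < Pi B.
  apply: (has_density_gt0 Pi_density) => //.
    by move=> x [_]; rewrite -pi_support.
  apply: lambda_strictly_positive => //.
  - by exists theta.
  - by move=> x [].
  - by apply/open_subspaceP; exists U => //; rewrite /B -setIA setIid.
apply: (@le_trans _ _ (set_conductance Pi P B)).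
  apply: ereal_inf_lbound; exists B => //; split => //.
  by rewrite B0/= (lt_trans Bp)// lte_fin.
apply: (@set_conductance_le _ _ _ _ _ _ (A + e / 2)) => //.
- by rewrite B0/= (lt_trans Bp)// lte_fin.
- move=> x Bx; have [Ux _] := Bx; rewrite P_arb; last exact: measurableC.
  apply: le_trans (ltW (VA _ (UV _ Ux))).
  have [mq q0 _] := Q_density x.
  by apply: arb_setC_le_acceptance => // y; have /andP[] := a_range x y.
- have -> : (A + e / 2 = (A + e) * (1 - p))%R.
    rewrite mulrBr mulr1 [((A + e) * p)%R]mulrC divfK ?gt_eqF// {2}(splitr e).
    by rewrite addrA addrK.
  by rewrite EFinM EFinB lee_pmul2l// leeB// ltW.
Qed.
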